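(* Let $f(x)\in\mathbb{Z}[x]$ be a univariate polynomial of degree $d$ and $p$ a prime. For every integer $k>d(\Delta+1)$, $$N_k(f)=\sum_{i=1}^{n}p^{\,k-\lceil (k-\nu_i)/e_i\rceil},$$ where $n$ and $\nu_i,e_i$ ($1\le i\le n$) are independent of $k$.
   Context: $N_k(f)$ is the number of $a\in\mathbb{Z}/\langle p^k\rangle$ with $f(a)\equiv 0\bmod p^k$. $\mathbb{Z}_p$ is the ring of $p$-adic integers, $v_p$ the $p$-adic valuation (with $v_p(0)=\infty$), and $[n]=\{1,\ldots,n\}$. The polynomial $f$ is viewed in $\mathbb{Z}_p[x]$, with factorization into coprime irreducible factors over $\mathbb{Z}_p$ (up to a unit of $\mathbb{Z}_p$) $f(x)=\prod_{i\in[n]}(x-\alpha_i)^{e_i}\cdot\prod_{j=1}^m g_j(x)^{t_j}$, where $\alpha_1,\dots,\alpha_n$ are the distinct $\mathbb{Z}_p$-roots of $f$, $e_i$ is the multiplicity of $\alpha_i$, and each $g_j\in\mathbb{Z}_p[x]$ is irreducible over $\mathbb{Z}_p$, has no $\mathbb{Z}_p$-root and has multiplicity $t_j$ in $f$. For $i\in[n]$, $f_i(x):=f(x)/(x-\alpha_i)^{e_i}$ and $\nu_i:=v_p(f_i(\alpha_i))$. The radical is $\mathrm{rad}(f):=\prod_{i=1}^n(x-\alpha_i)\cdot\prod_{j=1}^m g_j(x)$. The discriminant of a polynomial $h$ of degree $m$ over a field, with leading coefficient $h_m$ and roots $r_1,\dots,r_m$ in an algebraic closure, is $D(h):=h_m^{2m-1}\prod_{1\le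 i<j\le m}(r_i-r_j)^2$, and the discriminant of a linear polynomial is defined to be $1$. Finally $\Delta:=v_p(D(\mathrm{rad}(f)))$. An empty sum is $0$.
   Formalization: The irreducible factors g_j are required to be nonconstant, so f must be nonzero modulo p; if p itself were allowed as a factor the claim would fail, e.g. f = p^5 x with k = 2, where N_2 = p^2 but the formula gives p^5. *)

(* Defs.v *)
(* Classical logic gives Z_p its decidable equality and choice. *)
From HB Require Import structures.
From mathcomp Require Import all_boot all_order all_algebra.
From mathcomp Require Import boolp classical_sets constructive_ereal.

Set Implicit Arguments.
Unset Strict Implicit.
Unset Printing Implicit Defensive.

Import Order.TTheory GRing.Theory Num.Theory.

Local Open Scope ring_scope.

(* Z_p as the inverse limit of the rings Z/p^k: [residue x k] is the
   representative in {0, ..., p^k - 1} of the class of x modulo p^k (the bound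
   residue x k < p^k follows from [residueP]). The primality proof is a
   parameter of the type so that the integral domain structure can be
   inferred from the type alone. *)
Record padic_int (p : nat) (p_pr : prime p) := PadicInt {
  residue : nat -> nat;
  residueP : forall k, residue k = (residue k.+1 %% p ^ k)%N }.

Section PadicIntRing.
Variables (p : nat) (p_pr : prime p).
Local Notation Zp := (padic_int p_pr).
Implicit Types x y z : Zp.

HB.instance Definition _ := gen_eqMixin Zp.
HB.instance Definition _ := gen_choiceMixin Zp.

Lemma padic_ext x y : residue x =1 residue y -> x = y.
Proof.
case: x y => [x hx] [y hy] /= /funext exy; case: y / exy hy => hy.
by congr PadicInt; apply: Prop_irrelevance.
Qed.

Lemma residue_mod x k : (residue x k %% p ^ k)%N = residue x k.
Proof. by rewrite residueP modn_mod. Qed.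

Lemma residue_modS x k : residue x k.+1 = residue x k %[mod p ^ k].
Proof. by rewrite [in RHS]residueP modn_mod. Qed.

Lemma residue_leq x j k : (j <= k)%N -> residue x j = (residue x k %% p ^ j)%N.
Proof.
elim: k => [|k IHk]; first by rewrite leqn0 => /eqP ->; rewrite residue_mod.
rewrite leq_eqVlt => /orP[/eqP->|]; first by rewrite residue_mod.
rewrite ltnS => jk; rewrite IHk // [residue x k]residueP modn_dvdm //.
exact: dvdn_exp2l.
Qed.

Fact of_seq_subproof (s : nat -> nat) :
    (forall k, s k.+1 = s k %[mod p ^ k]) ->
  forall k, (s k %% p ^ k = (s k.+1 %% p ^ k.+1) %% p ^ k)%N.
Proof. by move=> hs k; rewrite modn_dvdm ?dvdn_exp2l // hs. Qed.

Definition padic_of_seq s hs : Zp := PadicInt p_pr (@of_seq_subproof s hs).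

Fact zero_subproof k : 0%N = 0%N %[mod p ^ k]. Proof. by []. Qed.
Fact one_subproof k : 1%N = 1%N %[mod p ^ k]. Proof. by []. Qed.
Fact add_subproof x y k :
  (residue x k.+1 + residue y k.+1 = residue x k + residue y k %[mod p ^ k])%N.
Proof. by rewrite -modnDm !residue_modS modnDm. Qed.
Fact mul_subproof x y k :
  (residue x k.+1 * residue y k.+1 = residue x k * residue y k %[mod p ^ k])%N.
Proof. by rewrite -modnMm !residue_modS modnMm. Qed.
Fact residue_lt x k : (residue x k < p ^ k)%N.
Proof. by rewrite -residue_mod ltn_mod expn_gt0 prime_gt0. Qed.
Fact opp_subproof x k :
  (p ^ k.+1 - residue x k.+1 = p ^ k - residue x k %[mod p ^ k])%N.
Proof.
apply/eqP; rewrite -(eqn_modDr (residue x k)) subnK; last exact/ltnW/residue_lt.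
rewrite -modnDmr -residue_modS modnDmr subnK; last exact/ltnW/residue_lt.
by rewrite expnS modnMl modnn.
Qed.

Definition padic_zero : Zp := padic_of_seq zero_subproof.
Definition padic_one : Zp := padic_of_seq one_subproof.
Definition padic_add x y : Zp := padic_of_seq (add_subproof x y).
Definition padic_mul x y : Zp := padic_of_seq (mul_subproof x y).
Definition padic_opp x : Zp := padic_of_seq (opp_subproof x).

Fact padic_addA : associative padic_add.
Proof.
by move=> x y z; apply: padic_ext => k /=; rewrite modnDmr modnDml addnA.
Qed.
Fact padic_addC : commutative padic_add.
Proof. by move=> x y; apply: padic_ext => k /=; rewrite addnC. Qed.
Fact padic_add0 : left_id padic_zero padic_add.
Proof. by move=> x; apply: padic_ext => k /=; rewrite mod0n residue_mod. Qed.
Fact padic_addN : left_inverse padic_zero padic_opp padic_add.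
Proof.
move=> x; apply: padic_ext => k /=.
by rewrite modnDml subnK ?modnn ?mod0n // ltnW ?residue_lt.
Qed.

HB.instance Definition _ :=
  GRing.isZmodule.Build Zp padic_addA padic_addC padic_add0 padic_addN.

Fact padic_mulA : associative padic_mul.
Proof.
by move=> x y z; apply: padic_ext => k /=; rewrite modnMmr modnMml mulnA.
Qed.
Fact padic_mulC : commutative padic_mul.
Proof. by move=> x y; apply: padic_ext => k /=; rewrite mulnC. Qed.
Fact padic_mul1 : left_id padic_one padic_mul.
Proof.
by move=> x; apply: padic_ext => k /=; rewrite modnMml mul1n residue_mod.
Qed.
Fact padic_mulDl : left_distributive padic_mul padic_add.
Proof.
by move=> x y z; apply: padic_ext => k /=; rewrite modnMml modnDm mulnDl.
Qed.
Fact padic_one_neq0 : padic_one != 0.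
Proof.
apply/eqP => /(congr1 (fun x => residue x 1)) /=.
by rewrite expn1 mod0n modn_small ?prime_gt1.
Qed.

HB.instance Definition _ := GRing.Zmodule_isComNzRing.Build Zp
  padic_mulA padic_mulC padic_mul1 padic_mulDl padic_one_neq0.

Definition padic_unit : {pred Zp} := fun x => `[< exists y, y * x = 1 >].
Definition padic_inv x : Zp :=
  if x \in padic_unit then xget 0 [set y | y * x = 1]%classic else x.

Fact padic_mulV : {in padic_unit, left_inverse 1 padic_inv *%R}.
Proof.
move=> x ux; rewrite /padic_inv ux.
move: ux => /asboolP[y yx1].
exact: (@xgetPex _ 0 [set z | z * x = 1]%classic (ex_intro _ y yx1)).
Qed.
Fact padic_unitP x y : y * x = 1 -> x \in padic_unit.
Proof. by move=> yx1; apply/asboolP; exists y. Qed.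
Fact padic_inv_out : {in [predC padic_unit], padic_inv =1 id}.
Proof. by move=> x; rewrite inE /padic_inv => /negPf ->. Qed.

HB.instance Definition _ := GRing.ComNzRing_hasMulInverse.Build Zp
  padic_mulV padic_unitP padic_inv_out.

Lemma residue0 k : residue (0 : Zp) k = 0%N.
Proof. exact: mod0n. Qed.

Lemma padic_neq0P x : x != 0 -> exists k, residue x k != 0%N.
Proof.
move=> x0; apply: contrapT => /forallNP h; case/eqP: x0; apply: padic_ext => k.
by rewrite residue0; apply/eqP; have /negP := h k; rewrite negbK.
Qed.

Fact padic_idomain : GRing.integral_domain_axiom Zp.
Proof.
move=> x y xy0; apply: contraT; rewrite negb_or.
case/andP => /padic_neq0P[a xa] /padic_neq0P[b yb].
have lognlt z k c : residue z k != 0%N -> (k <= c)%N ->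
    (0 < residue z c)%N /\ (logn p (residue z c) < k)%N.
  move=> + kc; rewrite (residue_leq z kc) => zk.
  have z0 : (0 < residue z c)%N by case: (residue z c) zk; rewrite ?mod0n.
  split=> //; rewrite ltnNge; apply: contra zk => le_k.
  by rewrite -/(dvdn _ _) pfactor_dvdn.
have [x0 xl] := lognlt x a (a + b)%N xa (leq_addr _ _).
have [y0 yl] := lognlt y b (a + b)%N yb (leq_addl _ _).
have /eqP := congr1 (fun z => residue z (a + b)) xy0; rewrite residue0.
rewrite -/(dvdn _ _) pfactor_dvdn ?muln_gt0 ?x0 // lognM //.
by rewrite leqNgt -addnS leq_add // ltnW.
Qed.

HB.instance Definition _ := GRing.ComUnitRing_isIntegral.Build Zp padic_idomain.

End PadicIntRing.

Section PadicValuation.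
Variables (p : nat) (p_pr : prime p).
Local Notation Zp := (padic_int p_pr).
Local Notation Qp := {fraction Zp}.
Implicit Types (x : Zp) (q : Qp).

(* Every nonzero element of Q_p is p^v * u for a unique v : int and some unit u
   of Z_p, see [is_padic_val_uniq] and [is_padic_val_ex]. *)
Definition is_padic_val q (v : int) : Prop :=
  exists2 u : Zp, u \is a GRing.unit & q = p%:R ^ v * FracField.tofrac u.

Definition padic_val q : \bar int :=
  if q == 0 then +oo%E else (xget 0 [set v | is_padic_val q v]%classic)%:E%E.

Lemma residue_nat n k : residue (n%:R : Zp) k = (n %% p ^ k)%N.
Proof.
elim: n => [|n IHn]; first by rewrite residue0 mod0n.
by rewrite -natr1 /= IHn modnDml modnDmr addn1.
Qed.

Lemma padic_p_neq0 : (p%:R : Zp) != 0.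
Proof.
apply/eqP => /(congr1 (fun x => residue x 2)); rewrite residue_nat residue0.
have p_gt1 := prime_gt1 p_pr.
by rewrite modn_small ?(ltn_exp2l 1) //; case: p p_gt1.
Qed.

Lemma residue_unit x : (x \is a GRing.unit) = (residue x 1 != 0%N).
Proof.
apply/idP/idP => [/mulVr /(congr1 (fun z => residue z 1)) /=|x1].
  apply: contra_eqN => /eqP ->; rewrite muln0 expn1 mod0n modn_small //.
  exact: prime_gt1.
have cop k : coprime (residue x k.+1) (p ^ k).
  rewrite coprimeXr // coprime_sym prime_coprime //.
  by move: x1; rewrite (@residue_leq _ _ x 1 k.+1) // expn1.
pose s k := (egcdn (residue x k.+1) (p ^ k)).1.
have sE k : (s k * residue x k = 1 %[mod p ^ k])%N.
  have x0 : (0 < residue x k.+1)%N.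
    rewrite lt0n; apply: contra x1 => /eqP xk.
    by rewrite (@residue_leq _ _ x 1 k.+1) // xk mod0n.
  rewrite -modnMmr -(residue_modS x k) modnMmr /s.
  case: egcdnP => //= a b + _; rewrite (eqP (cop k)) mulnC => ->.
  by rewrite modnMDl.
have hs k : s k.+1 = s k %[mod p ^ k].
  apply/eqP; have copk : coprime (p ^ k) (residue x k).
    rewrite coprime_sym -(coprime_modl _ (p ^ k)) -(residue_modS x k).
    by rewrite coprime_modl.
  have h : (s k.+1 * residue x k = 1 %[mod p ^ k])%N.
    rewrite -modnMmr -(residue_modS x k) modnMmr.
    have := sE k.+1 => /(congr1 (modn^~ (p ^ k)%N)).
    by rewrite !modn_dvdm ?dvdn_exp2l.
  have : (s k.+1 * residue x k * s k = s k * residue x k * s k.+1)%N.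
    by rewrite mulnAC [RHS]mulnAC [(s k * s k.+1)%N]mulnC.
  move=> /(congr1 (modn^~ (p ^ k)%N)).
  by rewrite -modnMml h modnMml mul1n -[RHS]modnMml sE modnMml mul1n => ->.
apply: (@padic_unitP _ _ x (padic_of_seq p_pr hs)); apply: padic_ext => k /=.
by rewrite modnMml sE.
Qed.

Lemma padic_int_decomp x : x != 0 ->
  exists v : nat, exists2 u : Zp, u \is a GRing.unit & x = p%:R ^+ v * u.
Proof.
move=> x0; have [k0 xk0] := padic_neq0P x0.
have ex : exists k, residue x k.+1 != 0%N.
  by case: k0 xk0 => [|k]; [rewrite residueP modn1 | exists k].
have [v xv vmin] := ex_minnP ex => {k0 xk0 ex}.
have xv0 : residue x v = 0%N.
  case: v xv vmin => [|v] _ vmin; first by rewrite residueP modn1.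
  by apply/eqP; apply: contraTT isT => /vmin; rewrite ltnn.
have dv k : (p ^ v %| residue x (v + k))%N.
  by rewrite /dvdn -(residue_leq x (leq_addr k v)) xv0.
have p0 : (0 < p ^ v)%N by rewrite expn_gt0 prime_gt0.
pose s k := (residue x (v + k) %/ p ^ v)%N.
have sK k : (s k * p ^ v)%N = residue x (v + k) by rewrite divnK.
have hs k : s k.+1 = s k %[mod p ^ k].
  apply/eqP; rewrite -(eqn_pmul2r p0) !muln_modl -expnD sK sK.
  by rewrite addnS [(k + v)%N]addnC residue_modS.
exists v, (padic_of_seq p_pr hs).
  rewrite residue_unit /= expn1; apply: contra xv => /eqP h.
  have : (s 1 %% p * p ^ v)%N = 0%N by rewrite h.
  by rewrite muln_modl sK -expnS addn1 residue_mod => ->.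
apply: padic_ext => k; rewrite -natrX /= residue_nat modnMmr modnMml mulnC.
by rewrite sK (residue_leq x (leq_addl v k)).
Qed.

Lemma padic_natX_unit n (u : Zp) : p%:R ^+ n * u \is a GRing.unit -> n = 0%N.
Proof.
case: n => // n; rewrite exprS -mulrA residue_unit /= -modnMml residue_nat.
by rewrite expn1 modnn !mod0n.
Qed.

Lemma tofrac_p_neq0 : (p%:R : Qp) != 0.
Proof.
by rewrite -(rmorph_nat (@FracField.tofrac Zp)) tofrac_eq0 padic_p_neq0.
Qed.

Lemma is_padic_val_uniq q v w : is_padic_val q v -> is_padic_val q w -> v = w.
Proof.
wlog vw : v w / v <= w.
  by move=> W hv hw; case/orP: (le_total v w) => h; [|apply/esym]; apply: W.
move=> [u uu ->] [u' uu' /eqP]; rewrite -(subrK v w); move: vw.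
rewrite -subr_ge0; case: (w - v) => // n _.
rewrite expfzDr ?tofrac_p_neq0 // [_ ^ n%:Z * _]mulrC -mulrA.
rewrite (inj_eq (mulfI (expfz_neq0 v tofrac_p_neq0))) -exprnP.
rewrite -(rmorph_nat (@FracField.tofrac Zp)) -rmorphXn -rmorphM tofrac_eq.
by move=> /eqP uE; move: uu; rewrite uE => /padic_natX_unit ->; rewrite add0r.
Qed.

Lemma is_padic_val_ex q : q != 0 -> exists v, is_padic_val q v.
Proof.
have [a [b [b0 ->]]] : exists a b : Zp,
    b != 0 /\ q = FracField.tofrac a / FracField.tofrac b.
  elim/quotW: q => r; have d0 := denom_ratioP r.
  exists (frac r).1, (frac r).2; split; first exact: d0.
  apply: (@mulIf Qp (FracField.tofrac (frac r).2)); first by rewrite tofrac_eq0.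
  rewrite divfK ?tofrac_eq0 //.
  unlock FracField.tofrac.
  rewrite -[LHS]FracField.pi_mul; apply/eqmodP; rewrite /= FracField.equivfE.
  rewrite /FracField.mulf !numden_Ratio ?mulf_neq0 ?oner_neq0 //.
  by rewrite !mulr1 mulrC.
have [-> |a0 _] := eqVneq a 0; first by rewrite rmorph0 mul0r eqxx.
have [v [u uu ->]] := padic_int_decomp a0.
have [w [t ut ->]] := padic_int_decomp b0.
exists (v%:Z - w%:Z), (u / t); first by rewrite unitrM uu unitrV.
rewrite !rmorphM !rmorphXn rmorph_nat rmorphV // expfzDr ?tofrac_p_neq0 //.
by rewrite -exprnN invfM mulrACA.
Qed.

Lemma padic_valP q v : padic_val q = v%:E%E <-> q != 0 /\ is_padic_val q v.
Proof.
rewrite /padic_val; case: eqVneq => [->|q0]; first by split=> // -[].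
have [w hw] := is_padic_val_ex q0.
have hx := @xgetPex _ 0 [set v | is_padic_val q v]%classic (ex_intro _ w hw).
split=> [[<-]|[_ hv]]; first by [].
by rewrite (is_padic_val_uniq hx hv).
Qed.

End PadicValuation.

Section Discriminant.
Variables (K : fieldType) (L : closedFieldType) (iota : {rmorphism K -> L}).

Definition is_algebraic_closure : Prop := forall z : L, algebraicOver iota z.

Definition closed_roots (h : {poly L}) : seq L :=
  sval (closed_field_poly_normal h).

(* The roots lie in L but the discriminant is an element of K: [xget] picks the
   unique preimage under iota of the product formula. The exponent is
   2m - 1 rather than 2m - 2; the truncation at m = 0 only concerns constant
   polynomials. *)
Definition discriminant (h : {poly K}) : K :=
  let m := (size h).-1 in
  let r := closed_roots (map_poly iota h) in
  if m == 1%N then 1 else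
  xget 0 [set D | iota D = iota (lead_coef h) ^+ (2 * m - 1) *
    \prod_(i < m) \prod_(j < m | (i < j)%N) (r`_i - r`_j) ^+ 2]%classic.

End Discriminant.

Definition irreducible_elt (R : unitRingType) (a : R) : Prop :=
  [/\ a != 0, a \isn't a GRing.unit &
      forall b c, a = b * c -> b \is a GRing.unit \/ c \is a GRing.unit].

Definition zero_count (p k : nat) (f : {poly int}) : nat :=
  #|[set a : 'I_(p ^ k) | (f.[a%:Z] == 0 %[mod (p ^ k)%N%:Z])%Z]|.

Section Factorization.
Variables (p : nat) (p_pr : prime p).
Local Notation Zp := (padic_int p_pr).
Variables (n m : nat) (alpha : 'I_n -> Zp) (e : 'I_n -> nat).
Variables (g : 'I_m -> {poly Zp}) (t : 'I_m -> nat).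

(* Factorization of f in Z_p[x]. The g_j are irreducible elements of the ring
   Z_p[x], not merely irreducible over Q_p, and have positive degree; hence
   such a factorization exists exactly when f is nonzero modulo p. *)
Record is_factorization (f : {poly Zp}) : Prop := IsFactorization {
  alpha_inj : injective alpha;
  e_gt0 : forall i, (0 < e i)%N;
  t_gt0 : forall j, (0 < t j)%N;
  g_deg : forall j, (1 < size (g j))%N;
  g_irr : forall j, irreducible_elt (g j);
  g_noroot : forall j x, ~~ root (g j) x;
  g_coprime : forall i j, i != j -> coprimep (g i) (g j);
  factE : exists2 u : Zp, u \is a GRing.unit &
    f = u *: (\prod_i ('X - (alpha i)%:P) ^+ e i * \prod_j g j ^+ t j) }.

Definition radical : {poly Zp} :=
  \prod_i ('X - (alpha i)%:P) * \prod_j g j.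

Definition cofactor_at (f : {poly Zp}) (i : 'I_n) : {poly Zp} :=
  f %/ ('X - (alpha i)%:P) ^+ e i.

Lemma cofactor_atE (q : {poly Zp}) i :
  cofactor_at (q * ('X - (alpha i)%:P) ^+ e i) i = q.
Proof.
by apply: Pdiv.IdomainMonic.mulpK; apply: monic_exp; apply: monicXsubC.
Qed.

(* [fine] discards +oo, which does not occur: the arguments of [padic_val] in
   [nu] and [Delta] are nonzero when alpha, e, g, t factor f. *)
Definition nu (f : {poly Zp}) (i : 'I_n) : int :=
  fine (padic_val (FracField.tofrac (cofactor_at f i).[alpha i])).

Definition Delta (L : closedFieldType) (iota : {rmorphism {fraction Zp} -> L}) :
    int :=
  fine (padic_val (discriminant iota
    (map_poly (@FracField.tofrac Zp) radical))).

End Factorization.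

(* Main.v *)
Require Import Defs.
From HB Require Import structures.
From mathcomp Require Import all_boot all_order all_algebra.
From mathcomp Require Import boolp classical_sets constructive_ereal.
From mathcomp Require Import separable.
From mathcomp Require Import zify ring.

(** Let h be the radical of f, let D be the valuation of its discriminant, and
    let a be an integer with f(a) divisible by p ^ k, where k > d (D + 1). The
    whole argument takes place in Z_p, with no valuation on an extension.

    Since every multiplicity is at most d, f divides h ^ d up to a unit, so
    h(a) is divisible by p ^ (D + 1). The discriminant is, up to sign, the
    resultant of h' and h ([discriminant_resultant]), and this resultant lies
    in the ideal generated by h(a) and h'(a) ^ 2 ([resultant_deriv_ideal]).
    Hence 2 v(h'(a)) <= D < v(h(a)) ([discriminant_dvd]), and Hensel's lemma
    gives a root of h in Z_p congruent to a modulo p ^ (v(h'(a)) + 1). As the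
    g_j have no roots in Z_p this is some alpha_i, and a is near alpha_i in the
    sense that v(a - alpha_i) > W_i, where W_i = v(h'(alpha_i)) = v(h'(a)).

    The number h'(alpha_i) is the product of the values at alpha_i of the other
    factors of h. So if a is near alpha_i, these factors have the same value at
    a and at alpha_i up to units ([cofactor_near]), and
    v(f(a)) = nu_i + e_i v(a - alpha_i). Thus f(a) is divisible by p ^ k exactly
    when v(a - alpha_i) >= c_i, where c_i is the ceiling of (k - nu_i) / e_i.
    Conversely nu_i <= d W_i and 2 W_i <= D give c_i > W_i, so that every a with
    v(a - alpha_i) >= c_i is near alpha_i. No a is near two roots
    ([near_uniq]), so the solutions modulo p ^ k are the disjoint union of the
    balls v(a - alpha_i) >= c_i, which have p ^ (k - c_i) elements each.

    For the discriminant to have a finite valuation h must be separable: its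
    factors are pairwise coprime, and an irreducible element of Z_p[X] of
    positive degree is separable by Gauss's lemma and characteristic zero
    ([irreducible_separable]). *)

Set Implicit Arguments.
Unset Strict Implicit.
Unset Printing Implicit Defensive.

Import Order.TTheory GRing.Theory Num.Theory.

Local Open Scope ring_scope.

(** * Resultants *)

(** With the rows of the Sylvester matrix seen as polynomials, multiplying the
    matrix by a column of powers of a, or of their derivatives, evaluates these
    polynomials, or their derivatives, at a. Both determinant computations below are column operations of this
    kind. *)
Definition Sylvester_row (R : nzRingType) (p q : {poly R})
    (i : 'I_((size q).-1 + (size p).-1)) : {poly R} :=
  match split i with inl k => 'X^k * p | inr k => 'X^k * q end.

Lemma Sylvester_rowE (R : nzRingType) (p q : {poly R}) i j :
  Sylvester_mx p q i j = (Sylvester_row i)`_j.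
Proof.
rewrite Sylvester_mxE /Sylvester_row; case: (split i) => k;
  by rewrite coefXnM ltnNge if_neg -mulrb.
Qed.

Lemma size_Sylvester_row (R : nzRingType) (p q : {poly R}) i :
  (size (@Sylvester_row R p q i) <= (size q).-1 + (size p).-1)%N.
Proof.
rewrite /Sylvester_row; case: (split i) => k; have kn := ltn_ord k.
  apply: (leq_trans (size_polyMleq _ _)); rewrite size_polyXn.
  by lia.
apply: (leq_trans (size_polyMleq _ _)); rewrite size_polyXn.
by lia.
Qed.

Lemma horner_Sylvester_row (R : nzRingType) (p q : {poly R}) i a :
  (@Sylvester_row R p q i).[a] = \sum_l Sylvester_mx p q i l * a ^+ l.
Proof.
rewrite (horner_coef_wide _ (size_Sylvester_row i)).
by apply: eq_bigr => l _; rewrite Sylvester_rowE.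
Qed.

Lemma deriv_Sylvester_row (R : nzRingType) (p q : {poly R}) i a :
  (@Sylvester_row R p q i)^`().[a] =
  \sum_l Sylvester_mx p q i l * (a ^+ l.-1 *+ l).
Proof.
have /take_poly_id := size_Sylvester_row i.
rewrite /take_poly poly_def => {1}<-.
rewrite raddf_sum horner_sum; apply: eq_bigr => l _.
by rewrite /= derivZ derivXn hornerZ hornerMn hornerXn Sylvester_rowE.
Qed.

Lemma resultant_map (aR rR : nzRingType) (f : {rmorphism aR -> rR}) p q :
    f (lead_coef p) != 0 -> f (lead_coef q) != 0 ->
  f (resultant p q) = resultant (map_poly f p) (map_poly f q).
Proof.
move=> nz_fp nz_fq; rewrite /resultant /Sylvester_mx !size_map_poly_id0 //.
rewrite -det_map_mx /= map_col_mx; congr (\det (col_mx _ _));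
  by apply: map_lin1_mx => v; rewrite map_poly_rV rmorphM /= map_rVpoly.
Qed.

(** Multiply the Sylvester matrix by the matrix whose first columns evaluate at
    the roots of q and whose last columns are unit vectors. The rows of q vanish
    in the first columns, so the product is block triangular: one block is a
    Vandermonde matrix scaled by the values of p, the other is triangular with
    the leading coefficient of q on its diagonal. The Vandermonde determinant
    cancels because the roots are distinct. *)
Lemma resultant_roots (R : idomainType) (p q : {poly R})
    (r : 'I_(size q).-1 -> R) : q != 0 -> injective r ->
    q = lead_coef q *: \prod_i ('X - (r i)%:P) ->
  resultant p q = lead_coef q ^+ (size p).-1 * \prod_i p.[r i].
Proof.
move=> q0 r_inj qE.
pose V := (Vandermonde (size q).-1 (\row_j r j)).
pose M : 'M_((size q).-1 + (size p).-1) :=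
  block_mx V 0 (\matrix_(l, j) r j ^+ ((size q).-1 + l)) 1%:M.
have detV : \det V != 0.
  rewrite det_Vandermonde; apply/prodf_neq0 => i _; apply/prodf_neq0 => j ij.
  by rewrite !mxE subr_eq0 (inj_eq r_inj) neq_ltn ij orbT.
have detM : \det M = \det V by rewrite det_lblock det1 mulr1.
have SMl i j : (Sylvester_mx p q *m M) i (lshift _ j) = (Sylvester_row i).[r j].
  rewrite horner_Sylvester_row mxE; apply: eq_bigr => l _; congr (_ * _).
  rewrite /M; case: (splitP l) => l' ll'.
    have -> : l = lshift _ l' by apply: val_inj.
    by rewrite block_mxEul !mxE.
  have -> : l = rshift _ l' by apply: val_inj.
  by rewrite block_mxEdl !mxE.
have SMr i j : (Sylvester_mx p q *m M) i (rshift _ j) =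
    (Sylvester_row i)`_((size q).-1 + j).
  rewrite mxE (bigD1 (rshift _ j)) //= big1 => [|l lj].
    by rewrite addr0 block_mxEdr Sylvester_rowE mxE eqxx mulr1.
  rewrite /M; case: (splitP l) => l' ll'.
    have -> : l = lshift _ l' by apply: val_inj.
    by rewrite block_mxEur Sylvester_rowE mxE mulr0.
  have El : l = rshift _ l' by apply: val_inj.
  rewrite El block_mxEdr Sylvester_rowE mxE.
  case: eqP => [E|_]; last by rewrite mulr0.
  by move: lj; rewrite El E eqxx.
have qr j : q.[r j] = 0.
  by rewrite qE hornerZ horner_prod (bigD1 j) //= hornerXsubC subrr mul0r mulr0.
apply: (mulIf detV); rewrite -{1}detM /resultant -det_mulmx.
rewrite -[_ *m _]submxK.
set W := ulsubmx _; set Z := dlsubmx _; set T := drsubmx _.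
have -> : Z = 0.
  apply/matrixP => i j; rewrite !mxE; have := SMl (rshift _ i) j.
  rewrite mxE => ->.
  by rewrite /Sylvester_row (unsplitK (inr i)) hornerM qr mulr0.
rewrite det_ublock.
have -> : W = V *m diag_mx (\row_j p.[r j]).
  apply/matrixP => i j; rewrite mul_mx_diag !mxE.
  have := SMl (lshift _ i) j; rewrite mxE => ->.
  by rewrite /Sylvester_row (unsplitK (inl i)) hornerM hornerXn.
have TE i j : T i j = ('X^i * q)`_((size q).-1 + j).
  have := SMr (rshift _ i) j; rewrite !mxE => ->.
  by rewrite /Sylvester_row (unsplitK (inr i)).
have -> : \det T = lead_coef q ^+ (size p).-1.
  rewrite det_trig => [|].
    rewrite -[X in _ ^+ X]card_ord -prodr_const; apply: eq_bigr => i _.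
    by rewrite TE coefXnM ltnNge leq_addl addnK.
  apply/is_trig_mxP => i j ij; rewrite TE coefXnM; case: ltnP => // _.
  apply: nth_default; rewrite -size_poly_gt0 in q0.
  by rewrite -{1}(prednK q0) -addnBA ?(ltnW ij) // -addn1 leq_add2l subn_gt0.
rewrite det_mulmx det_diag mulrC mulrA mulrAC; congr (_ * _ * _).
by apply: eq_bigr => j _; rewrite mxE.
Qed.

(** Replace the first two columns of the Sylvester matrix by the values at a and
    the derivatives at a of the row polynomials, which does not change the
    determinant. Modulo h(a), the first column is h'(a) times the column w of
    the values of the powers of X in the rows of h' (and 0 in the rows of h),
    while modulo h(a) and h'(a) the second column is h''(a) times the same w.
    So the determinant has a second factor h'(a) modulo h(a). *)
Lemma resultant_deriv_ideal (R : comNzRingType) (h : {poly R}) (a : R) :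
    (2 < size h)%N -> size h^`() = (size h).-1 ->
  exists A B, resultant h^`() h = A * h.[a] + B * h^`().[a] ^+ 2.
Proof.
move=> h2 sh'; set N := ((size h).-1 + (size h^`()).-1)%N.
have N1 : (1 < N)%N by rewrite /N sh'; lia.
pose i0 : 'I_N := Ordinal (ltnW N1); pose i1 : 'I_N := Ordinal N1.
have i01 : i0 != i1 by [].
pose M : 'M[R]_N := \matrix_(l, j)
  if j == i0 then a ^+ l else if j == i1 then a ^+ l.-1 *+ l else (l == j)%:R.
have detM : \det M = 1.
  rewrite det_trig => [|].
    apply: big1 => l _; rewrite mxE.
    case: eqP => [->|_]; first by rewrite expr0.
    by case: eqP => [->|_]; rewrite ?expr0 ?eqxx.
  apply/is_trig_mxP => l j lj; rewrite mxE.
  case: eqP => [E|_]; first by rewrite E in lj.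
  case: eqP => [E|_]; first by rewrite E in lj; case: l lj => -[].
  by case: eqP => // E; rewrite E ltnn in lj.
pose S := Sylvester_mx h^`() h.
pose B := (S *m M)^T.
have B0 i : B i0 i = (Sylvester_row i).[a].
  rewrite /B mxE mxE horner_Sylvester_row; apply: eq_bigr => l _.
  by congr (_ * _); rewrite mxE eqxx.
have B1 i : B i1 i = (Sylvester_row i)^`().[a].
  rewrite /B mxE mxE deriv_Sylvester_row; apply: eq_bigr => l _.
  by congr (_ * _); rewrite mxE eq_sym (negPf i01) eqxx.
have -> : resultant h^`() h = \det B by rewrite det_tr det_mulmx detM mulr1.
set c0 := h.[a]; set c1 := h^`().[a].
pose pick (u v : nat -> R) : 'rV[R]_N :=
  \row_i match split i with inl k => u k | inr k => v k end.
pose w := pick (fun k => a ^+ k) (fun=> 0).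
pose u := pick (fun=> 0) (fun k => a ^+ k).
pose z := pick (fun k => a ^+ k.-1 *+ k) (fun k => a ^+ k).
pose y := pick (fun=> 0) (fun k => a ^+ k.-1 *+ k).
have row0 : row i0 B = c0 *: u + c1 *: w.
  apply/rowP => i; rewrite mxE B0 !mxE /Sylvester_row.
  case: (split i) => k; rewrite hornerM hornerXn mulr0 ?add0r ?addr0.
    by rewrite mulrC.
  by rewrite mulrC.
pose Aux (r0 r1 : 'rV[R]_N) : 'M[R]_N := \matrix_(i, j)
  if i == i0 then r0 0 j else if i == i1 then r1 0 j else B i j.
pose c2 := h^`()^`().[a].
have row1 : row i1 B = c2 *: w + 1 *: (c1 *: z + c0 *: y).
  apply/rowP => i; rewrite mxE B1 !mxE /Sylvester_row.
  case: (split i) => k;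
    rewrite derivM derivXn hornerD !hornerM hornerMn !hornerXn.
    by rewrite -/c2 -/c1; ring.
  by rewrite -/c0 -/c1; ring.
(* By linearity in both columns the only term that is divisible neither by
   h(a) nor by h'(a) ^ 2 is the one with both columns equal to w. *)
have BE : B = Aux (row i0 B) (row i1 B).
  apply/matrixP => i j; rewrite [RHS]mxE.
  case: eqVneq => [->|_]; first by rewrite [RHS]mxE.
  by case: eqVneq => [->|_] //; rewrite [RHS]mxE.
have lin0 b c r s t :
    \det (Aux (b *: r + c *: s) t) = b * \det (Aux r t) + c * \det (Aux s t).
  apply: (determinant_multilinear (i0 := i0)).
  - by apply/rowP => j; rewrite !mxE !eqxx.
  - by apply/matrixP => i j; rewrite !mxE eq_sym (negPf (neq_lift i0 i)).
  - by apply/matrixP => i j; rewrite !mxE eq_sym (negPf (neq_lift i0 i)).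
have lin1 b c r s t :
    \det (Aux t (b *: r + c *: s)) = b * \det (Aux t r) + c * \det (Aux t s).
  apply: (determinant_multilinear (i0 := i1)).
  - by apply/rowP => j; rewrite !mxE eq_sym (negPf i01) !eqxx.
  - apply/matrixP => i j.
    by rewrite !mxE [_ == i1]eq_sym (negPf (neq_lift i1 i)).
  - apply/matrixP => i j.
    by rewrite !mxE [_ == i1]eq_sym (negPf (neq_lift i1 i)).
have alt r : \det (Aux r r) = 0.
  apply: (determinant_alternate i01) => j.
  by rewrite !mxE [i1 == i0]eq_sym (negPf i01) !eqxx.
rewrite BE row0 lin0 [in X in _ + c1 * X]row1 !lin1 alt.
exists (\det (Aux u (row i1 B)) + c1 * \det (Aux w y)), (\det (Aux w z)).
by ring.
Qed.


Section DerivResultant.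
Variable R : idomainType.

Lemma size_deriv_char0 (h : {poly R}) : (forall n, n.+1%:R != 0 :> R) ->
  size h^`() = (size h).-1.
Proof.
move=> nz; have [->|h0] := eqVneq h 0; first by rewrite deriv0 size_poly0.
apply/eqP; rewrite eqn_leq -ltnS prednK ?size_poly_gt0 // lt_size_deriv //=.
case E: (size h) => [|[|m]] //=; rewrite ltnNge; apply/negP => /leq_sizeP.
move=> /(_ m (leqnn m)); rewrite coef_deriv -mulr_natr => /eqP.
by rewrite mulf_eq0 (negPf (nz m)) orbF -[m.+1]/(m.+2.-1) -E lead_coef_eq0
  (negPf h0).
Qed.

Lemma prod_pairs n (F : 'I_n -> 'I_n -> R) :
  \prod_i \prod_(j | j != i) F i j =
  \prod_(i < n) \prod_(j < n | (i < j)%N) (F i j * F j i).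
Proof.
under [RHS]eq_bigr do rewrite big_split /=.
rewrite big_split /= [X in _ * X](exchange_big_dep xpredT) //= -big_split /=.
apply: eq_bigr => i _; rewrite (bigID (fun j : 'I_n => (i < j)%N)) /=.
congr (_ * _); apply: eq_bigl => j; rewrite -val_eqE /= neq_ltn;
  by case: ltngtP.
Qed.

Lemma resultant_deriv_roots (h : {poly R}) (r : 'I_(size h).-1 -> R) :
    h != 0 -> injective r -> size h^`() = (size h).-1 ->
    h = lead_coef h *: \prod_i ('X - (r i)%:P) ->
  exists N, (-1) ^+ N * resultant h^`() h =
    lead_coef h ^+ (2 * (size h).-1 - 1) *
    \prod_(i < (size h).-1) \prod_(j < (size h).-1 | (i < j)%N)
      (r i - r j) ^+ 2.
Proof.
move=> h0 r_inj sh' hE; rewrite (resultant_roots _ h0 r_inj hE) sh'.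
have h'E i : h^`().[r i] = lead_coef h * \prod_(j | j != i) (r i - r j).
  rewrite {1}hE derivZ hornerZ (bigD1 i) //= derivM derivXsubC mul1r hornerD.
  rewrite hornerM hornerXsubC subrr mul0r addr0 horner_prod; congr (_ * _).
  by apply: eq_bigr => j _; rewrite hornerXsubC.
under eq_bigr do rewrite h'E.
rewrite big_split /= prod_pairs prodr_const card_ord mulrA -exprD.
exists (\sum_(i < (size h).-1) \sum_(j < (size h).-1 | (i < j)%N) 1)%N.
have -> : ((size h).-1.-1 + (size h).-1 = 2 * (size h).-1 - 1)%N by lia.
rewrite mulrCA; congr (_ * _).
rewrite -prodrXr -big_split /=; apply: eq_bigr => i _.
rewrite -prodrXr -big_split /=; apply: eq_bigr => j _; ring.
Qed.

End DerivResultant.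

(** * The discriminant as a resultant *)

Section DiscResultant.
Variables (R : idomainType) (L : closedFieldType).
Variable iota : {rmorphism {fraction R} -> L}.
Local Notation tofrac := (@FracField.tofrac R).

(** The discriminant is defined by a product over roots in L, and nothing in its
    definition says that this product comes from the base field; the resultant
    of h' and h, which up to sign has the same value in L, provides the
    preimage and shows that it lies in R. *)
Lemma discriminant_resultant (h : {poly R}) :
    (2 < size h)%N -> size h^`() = (size h).-1 -> separable_poly h ->
  exists N, discriminant iota (map_poly tofrac h) =
    tofrac ((-1) ^+ N * resultant h^`() h).
Proof.
move=> h2 sh' sep_h.
pose phi := iota \o tofrac.
have phi0 x : (phi x == 0) = (x == 0) by rewrite fmorph_eq0 tofrac_eq0.
have h0 : h != 0 by rewrite -size_poly_gt0; lia.
have h'0 : h^`() != 0 by rewrite -size_poly_gt0 sh'; lia.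
set H := map_poly phi h.
have sH : size H = size h by rewrite size_map_poly_id0 // phi0 lead_coef_eq0.
have HE : map_poly iota (map_poly tofrac h) = H by rewrite /H map_poly_comp.
have lH : lead_coef H = phi (lead_coef h).
  apply: lead_coef_map_id0; rewrite ?phi0 ?lead_coef_eq0 //.
  by apply/eqP; rewrite phi0.
have H'E : map_poly phi h^`() = H^`() by rewrite deriv_map.
have resH : phi (resultant h^`() h) = resultant H^`() H.
  rewrite -H'E; apply: (resultant_map (f := iota \o tofrac));
    by rewrite -/phi phi0 lead_coef_eq0.
have res0 : resultant h^`() h != 0.
  move: sep_h; rewrite unlock coprimep_sym /coprimep resultant_eq0.
  by move=> /eqP ->.
have sepH : separable_poly H.
  rewrite unlock coprimep_sym /coprimep eqn_leq leqNgt.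
  rewrite -resultant_eq0 -resH phi0 res0 size_poly_gt0 gcdp_eq0.
  by rewrite -[H == 0]size_poly_eq0 sH size_poly_eq0 (negPf h0) andbF.
rewrite /discriminant /closed_roots HE.
have lH0 : lead_coef H != 0 by rewrite lH phi0 lead_coef_eq0.
case: (closed_field_poly_normal H) => rs /= HrE.
have szm : size (map_poly tofrac h) = size h.
  by rewrite size_map_poly_id0 // tofrac_eq0 lead_coef_eq0.
have szrs : size rs = (size H).-1.
  by rewrite [in RHS]HrE size_scale // size_prod_XsubC.
have uniq_rs : uniq rs.
  rewrite -separable_prod_XsubC.
  move: sepH; rewrite HrE; apply: dvdp_separable.
  by rewrite dvdpZr.
pose r (i : 'I_(size H).-1) := rs`_i.
have r_inj : injective r.
  move=> i j /eqP; rewrite nth_uniq ?szrs ?ltn_ord // => /eqP; exact: val_inj.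
have [N resE] : exists N, (-1) ^+ N * resultant H^`() H =
    lead_coef H ^+ (2 * (size H).-1 - 1) *
    \prod_(i < (size H).-1) \prod_(j < (size H).-1 | (i < j)%N)
      (r i - r j) ^+ 2.
  apply: resultant_deriv_roots => //.
  - by rewrite -lead_coef_eq0.
  - by rewrite -H'E size_map_poly_id0 ?phi0 ?lead_coef_eq0 // sh' sH.
  - rewrite {1}HrE; congr (_ *: _).
    by rewrite (big_nth 0) szrs big_mkord.
exists N; rewrite szm -sH.
have -> : ((size H).-1 == 1%N) = false by rewrite sH; apply/negbTE; lia.
have ex : iota (tofrac ((-1) ^+ N * resultant h^`() h)) =
    iota (lead_coef (map_poly tofrac h)) ^+ (2 * (size H).-1 - 1) *
    \prod_(i < (size H).-1) \prod_(j < (size H).-1 | (i < j)%N)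
      (r i - r j) ^+ 2.
  rewrite (lead_coef_map_id0 (rmorph0 _)) ?tofrac_eq0 ?lead_coef_eq0 //.
  have -> : iota (tofrac (lead_coef h)) = lead_coef H by rewrite lH.
  by rewrite -resE !rmorphM !rmorphXn !rmorphN1 -resH.
apply: (fmorph_inj iota); rewrite ex.
by case: xgetP => [D _ /= -> //|/(_ _ ex)].
Qed.

End DiscResultant.

(** * Valuations in Z_p *)

Section PadicOrder.
Variables (p : nat) (p_pr : prime p).
Local Notation Zp := (padic_int p_pr).
Implicit Types (x y z u : Zp) (s : nat).

(** On nonzero x this is the p-adic valuation; ord 0 is a junk value, which is
    why most statements below use the divisibility predicate pdvd instead. *)
Definition ord x : nat := `|fine (padic_val (FracField.tofrac x))|%N.

Lemma padic_valE v u : u \is a GRing.unit ->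
  padic_val (FracField.tofrac (p%:R ^+ v * u)) = v%:Z%:E%E.
Proof.
move=> uu; apply/padic_valP; split.
  rewrite tofrac_eq0 mulf_neq0 ?expf_neq0 ?padic_p_neq0 //.
  by apply: contraTneq uu => ->; rewrite unitr0.
by exists u => //; rewrite rmorphM rmorphXn rmorph_nat.
Qed.

Lemma ordE v u : u \is a GRing.unit -> ord (p%:R ^+ v * u) = v.
Proof. by move=> uu; rewrite /ord padic_valE. Qed.

Lemma ord_decomp x : x != 0 ->
  exists2 u, u \is a GRing.unit & x = p%:R ^+ ord x * u.
Proof. by case/padic_int_decomp => v [u uu ->]; exists u; rewrite ?ordE. Qed.

Lemma padic_val_ord x : x != 0 ->
  fine (padic_val (FracField.tofrac x)) = (ord x)%:Z.
Proof. by move=> /ord_decomp[u uu ->]; rewrite ordE // padic_valE. Qed.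

Lemma ordM x y : x != 0 -> y != 0 -> ord (x * y) = (ord x + ord y)%N.
Proof.
move=> /ord_decomp[u uu xE] /ord_decomp[t ut yE].
by rewrite {1}xE {1}yE mulrACA -exprD ordE // unitrM uu.
Qed.

Lemma ordX x n : x != 0 -> ord (x ^+ n) = (n * ord x)%N.
Proof.
move=> x0; elim: n => [|n IHn]; last by rewrite exprS ordM ?expf_neq0 // IHn.
by rewrite expr0 -[1]mulr1 -[X in X * _](expr0 p%:R) ordE // unitr1.
Qed.

(** Divisibility by p ^ s, see [pdvdP]; stated through residues it is decidable
    and is literally the congruence that is counted in the end. *)
Definition pdvd s x := residue x s == 0%N.

Lemma pdvd_mull s x : pdvd s (p%:R ^+ s * x).
Proof.
by rewrite /pdvd /= -natrX residue_nat modnn mul0n mod0n.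
Qed.

Lemma pdvd_ord s x : x != 0 -> pdvd s x = (s <= ord x)%N.
Proof.
move=> x0; have [u uu xE] := ord_decomp x0; apply/idP/idP => [|le_s].
  apply: contraTT; rewrite -ltnNge => lt_s; rewrite /pdvd {1}xE /=.
  have p_gt0 := prime_gt0 p_pr.
  rewrite -natrX residue_nat modnMml -/(dvdn _ _).
  rewrite -{1}(subnKC (ltnW lt_s)) expnD dvdn_pmul2l ?expn_gt0 ?p_gt0 //.
  move: uu; rewrite residue_unit; apply: contraNN => /(dvdn_trans _).
  rewrite (@residue_leq _ _ u 1 s); last by case: (s) lt_s.
  rewrite expn1 -/(dvdn _ _); apply.
  by rewrite -{1}[p]expn1 dvdn_exp2l ?subn_gt0.
by rewrite xE -(subnKC le_s) exprD -mulrA pdvd_mull.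
Qed.

Lemma pdvdP s x : reflect (exists y, x = p%:R ^+ s * y) (pdvd s x).
Proof.
apply: (iffP idP) => [|[y ->]]; last exact: pdvd_mull.
have [->|x0] := eqVneq x 0; first by exists 0; rewrite mulr0.
rewrite pdvd_ord // => le_s; have [u _ xE] := ord_decomp x0.
by exists (p%:R ^+ (ord x - s) * u); rewrite mulrA -exprD subnKC.
Qed.

Lemma pdvd0 s : pdvd s 0. Proof. by rewrite /pdvd residue0. Qed.

Lemma pdvd0n x : pdvd 0 x. Proof. by rewrite /pdvd -residue_mod modn1. Qed.

Lemma pdvdD s x y : pdvd s x -> pdvd s y -> pdvd s (x + y).
Proof.
by move=> /pdvdP[a ->] /pdvdP[b ->]; rewrite -mulrDr pdvd_mull.
Qed.

Lemma pdvdN s x : pdvd s (- x) = pdvd s x.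
Proof.
by apply/pdvdP/pdvdP => -[y E]; exists (- y); rewrite mulrN -E ?opprK.
Qed.

Lemma pdvdB s x y : pdvd s x -> pdvd s y -> pdvd s (x - y).
Proof. by move=> hx hy; rewrite pdvdD ?pdvdN. Qed.

Lemma pdvd_subE s x y : pdvd s (x - y) = (residue x s == residue y s).
Proof.
apply/idP/eqP => [h|h]; last first.
  by rewrite /pdvd /= h modnDmr subnKC ?modnn // ltnW ?residue_lt.
have /(congr1 (fun z => residue z s)) : x = x - y + y by rewrite subrK.
move=> {1}->; rewrite [LHS]/= -[RHS]residue_mod.
by move: h; rewrite /pdvd /= => /eqP ->; rewrite add0n.
Qed.

Lemma pdvdM s t x y : pdvd s x -> pdvd t y -> pdvd (s + t) (x * y).
Proof.
by move=> /pdvdP[a ->] /pdvdP[b ->]; rewrite mulrACA -exprD pdvd_mull.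
Qed.

Lemma pdvdMl s x y : pdvd s y -> pdvd s (x * y).
Proof. by move=> hy; rewrite -[s]add0n pdvdM ?pdvd0n. Qed.

Lemma pdvdMr s x y : pdvd s x -> pdvd s (x * y).
Proof. by move=> hx; rewrite mulrC pdvdMl. Qed.

Lemma pdvd_leq s t x : (s <= t)%N -> pdvd t x -> pdvd s x.
Proof.
move=> st /pdvdP[y ->]; rewrite -(subnKC st) exprD -mulrA; exact: pdvd_mull.
Qed.

Lemma pdvd_all0 x : (forall s, pdvd s x) -> x = 0.
Proof. by move=> h; apply: padic_ext => s; rewrite residue0; apply/eqP/h. Qed.

Lemma padic_unitE x : (x \is a GRing.unit) = ~~ pdvd 1 x.
Proof. exact: residue_unit. Qed.

Lemma ord_unit u : u \is a GRing.unit -> ord u = 0%N.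
Proof. by move=> uu; rewrite -[u]mul1r -(expr0 p%:R) ordE. Qed.

Lemma ordM_unit u x : u \is a GRing.unit -> ord (u * x) = ord x.
Proof.
move=> uu; have [->|x0] := eqVneq x 0; first by rewrite mulr0.
rewrite ordM ?(ord_unit uu) ?add0n //.
by apply: contraTneq uu => ->; rewrite unitr0.
Qed.

Lemma pdvdM_unit s u x : u \is a GRing.unit -> pdvd s (u * x) = pdvd s x.
Proof.
move=> uu; apply/idP/idP => [|]; last exact: pdvdMl.
by move=> /(pdvdMl u^-1); rewrite mulKr.
Qed.

Lemma ord_dvd x y : x * y != 0 -> (ord x <= ord (x * y)%R)%N.
Proof.
by rewrite mulf_eq0 negb_or => /andP[x0 y0]; rewrite ordM // leq_addr.
Qed.

Definition assoc x y := exists2 u, u \is a GRing.unit & x = u * y.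

Lemma assocM x y z t : assoc x y -> assoc z t -> assoc (x * z) (y * t).
Proof.
move=> [u uu ->] [v uv ->]; exists (u * v); first by rewrite unitrM uu.
by rewrite mulrACA.
Qed.

Lemma assoc_refl x : assoc x x.
Proof. by exists 1; rewrite ?unitr1 ?mul1r. Qed.

Lemma assocX x y n : assoc x y -> assoc (x ^+ n) (y ^+ n).
Proof.
move=> h; elim: n => [|n IHn]; first exact: assoc_refl.
by rewrite !exprS; apply: assocM.
Qed.

(** x = y + p ^ (ord y + 1) z = y (1 + p z') and 1 + p z' is a unit. *)
Lemma assoc_near x y : y != 0 -> pdvd (ord y).+1 (x - y) -> assoc x y.
Proof.
move=> y0 /pdvdP[z xyE]; have [u uu yE] := ord_decomp y0.
exists (1 + p%:R * (z * u^-1)).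
  rewrite padic_unitE; apply/negP => h.
  have : pdvd 1 (1 + p%:R * (z * u^-1) - p%:R ^+ 1 * (z * u^-1)).
    by rewrite pdvdB ?pdvd_mull.
  by rewrite expr1 addrK; apply/negP; rewrite -padic_unitE unitr1.
rewrite -[LHS](subrK y) xyE mulrDl mul1r addrC [in X in _ = _ + X]yE exprS.
congr (_ + _); rewrite -{1}[z](mulrVK uu).
by rewrite -!mulrA; congr (_ * _); rewrite mulrCA; congr (_ * _); rewrite mulrCA.
Qed.

Lemma assoc_neq0 x y : assoc x y -> (x == 0) = (y == 0).
Proof.
case=> u uu ->; rewrite mulf_eq0.
by have [u0|//] := eqVneq u 0; rewrite u0 unitr0 in uu.
Qed.

End PadicOrder.

(** * Hensel's lemma *)

Section Taylor.
Variable R : comNzRingType.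
Implicit Types (h : {poly R}) (a x : R).

Lemma horner_sub h a x : exists y, h.[x] - h.[a] = y * (x - a).
Proof.
have /factor_theorem[q qE] : root (h - h.[a]%:P) a.
  by rewrite /root hornerD hornerN hornerC subrr.
exists q.[x]; have := congr1 (fun q => q.[x]) qE.
by rewrite hornerM hornerXsubC hornerD hornerN hornerC.
Qed.

Lemma horner_taylor2 h a x :
  exists y, h.[x] = h.[a] + h^`().[a] * (x - a) + y * (x - a) ^+ 2.
Proof.
have /factor_theorem[q qE] : root (h - h.[a]%:P) a.
  by rewrite /root hornerD hornerN hornerC subrr.
have [y yE] := horner_sub q a x; exists y.
have -> : h^`().[a] = q.[a].
  have := congr1 (fun q => q^`().[a]) qE.
  rewrite derivB derivC subr0 derivM derivXsubC mulr1 hornerD hornerM.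
  by rewrite hornerXsubC subrr mulr0 add0r.
have := congr1 (fun q => q.[x]) qE.
rewrite hornerM hornerXsubC hornerD hornerN hornerC => /eqP.
rewrite subr_eq => /eqP ->; rewrite -[q.[x]](subrK q.[a]) yE; ring.
Qed.

End Taylor.

(** With c = p ^ w and b = p ^ (w + s + 1), this is the Newton step from a point
    where h' has valuation w and h is divisible by c b = p ^ (2 w + s + 1): the
    correction b z / u is chosen to cancel the linear part of the Taylor
    expansion, and the error is of second order in b. *)
Lemma Newton_step (R : comUnitRingType) (h : {poly R}) (x c b z u : R) :
    u \is a GRing.unit -> h^`().[x] = c * u -> h.[x] = c * b * z ->
  exists t, h.[x - b * (z / u)] = t * b ^+ 2.
Proof.
move=> uu h'E hE; have [y yE] := horner_taylor2 h x (x - b * (z / u)).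
exists (y * (z / u) ^+ 2); rewrite yE hE h'E.
have -> : x - b * (z / u) - x = - (b * (z / u)) by ring.
rewrite mulrN.
rewrite [X in _ - X](_ : _ = c * b * z * (u^-1 * u)); last by ring.
by rewrite mulVr // mulr1 subrr add0r; ring.
Qed.


Section Hensel.
Variables (p : nat) (p_pr : prime p).
Local Notation Zp := (padic_int p_pr).
Implicit Types (x y z u : Zp) (s : nat) (h : {poly Zp}).

Lemma pdvd_horner h s x y : pdvd s (x - y) -> pdvd s (h.[x] - h.[y]).
Proof. by move=> xy; have [z ->] := horner_sub h y x; apply: pdvdMl. Qed.

Lemma ord_near x y : y != 0 -> pdvd (ord y).+1 (x - y) -> x != 0 /\ ord x = ord y.
Proof.
move=> y0 /(assoc_near y0) xy; have := assoc_neq0 xy; rewrite (negPf y0) => ->.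
by case: xy => u uu ->; rewrite ordM_unit.
Qed.

Lemma padic_limit (a : nat -> Zp) : (forall s, pdvd s (a s.+1 - a s)) ->
  exists x, forall s, pdvd s (x - a s).
Proof.
move=> ha.
have hs s : residue (a s.+1) s.+1 = residue (a s) s %[mod p ^ s].
  by rewrite residue_modS; have := ha s; rewrite pdvd_subE => /eqP ->.
exists (padic_of_seq p_pr hs) => s.
by rewrite pdvd_subE /= residue_mod.
Qed.

(** Newton iteration started at a: each step keeps the valuation w of h' and
    improves the divisibility of h, moving the point by a multiple of
    p ^ (w + s + 1), so the iterates converge to a root. *)
Lemma Hensel h a : h^`().[a] != 0 ->
    pdvd (ord h^`().[a]).*2.+1 h.[a] ->
  exists2 x, root h x & pdvd (ord h^`().[a]).+1 (x - a).
Proof.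
set w := ord _ => h'a0 ha.
pose inv s x := [/\ pdvd (w.*2 + s).+1 h.[x], h^`().[x] != 0 & ord h^`().[x] = w].
have step s x : inv s x -> exists y, pdvd (w + s).+1 (y - x) /\ inv s.+1 y.
  case=> hx h'x0 ordx; have [z hxE] := pdvdP _ _ hx.
  have [u uu h'xE] := ord_decomp h'x0; rewrite ordx in h'xE.
  exists (x - p%:R ^+ (w + s).+1 * (z / u)).
  set y := x - _; have yx : y - x = - (p%:R ^+ (w + s).+1 * (z / u)).
    by rewrite /y addrC addKr.
  have yx_dvd : pdvd (w + s).+1 (y - x) by rewrite yx pdvdN pdvd_mull.
  split=> //.
  have h'y : pdvd w.+1 (h^`().[y] - h^`().[x]).
    by apply: pdvd_horner; apply: pdvd_leq yx_dvd; rewrite ltnS leq_addr.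
  have [h'y0 ordy] : h^`().[y] != 0 /\ ord h^`().[y] = ord h^`().[x].
    by apply: ord_near; rewrite ?ordx.
  split=> //; last by rewrite ordy.
  have hxE' : h.[x] = p%:R ^+ w * p%:R ^+ (w + s).+1 * z.
    by rewrite hxE -exprD; congr (_ ^+ _ * _); lia.
  have [t ->] := Newton_step uu h'xE hxE'.
  apply: pdvdMl; rewrite -exprM -[_ ^+ _]mulr1.
  by apply: pdvd_leq (pdvd_mull _ _); lia.
have [next nextP] : {next : nat -> Zp -> Zp & forall s x, inv s x ->
    pdvd (w + s).+1 (next s x - x) /\ inv s.+1 (next s x)}.
  have ex s x : {y | inv s x -> pdvd (w + s).+1 (y - x) /\ inv s.+1 y}.
    apply: cid; have [/step[y hy]|no] := pselect (inv s x); first by exists y.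
    by exists x.
  by exists (fun s x => sval (ex s x)) => s x; case: (ex s x).
pose fix it s := if s is s'.+1 then next s' (it s') else a.
have itP s : inv s (it s).
  elim: s => [|s /nextP[]] //=; by split; rewrite // addn0.
have it_near s : pdvd (w + s).+1 (it s.+1 - it s) by have [] := nextP _ _ (itP s).
have it_close s : pdvd w.+1 (it s - a).
  elim: s => [|s IHs]; first by rewrite subrr pdvd0.
  rewrite -[it s.+1](subrK (it s)) -addrA pdvdD //.
  by apply: pdvd_leq (it_near s); rewrite ltnS leq_addr.
have [x xP] : exists x, forall s, pdvd s (x - it s).
  by apply: padic_limit => s; apply: pdvd_leq (it_near s); lia.
exists x.
  apply/eqP; apply: (@pdvd_all0 _ p_pr) => s.
  rewrite -[h.[x]](subrK h.[it s]) pdvdD ?pdvd_horner //.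
  by have [hs _ _] := itP s; apply: pdvd_leq hs; lia.
rewrite -[x](subrK (it w.+1)) -addrA pdvdD //; exact: xP.
Qed.

End Hensel.

(** * Gauss's lemma and the discriminant of a polynomial over Z_p *)

Section PadicPoly.
Variables (p : nat) (p_pr : prime p).
Local Notation Zp := (padic_int p_pr).
Implicit Types (g h : {poly Zp}).

Lemma padic_natr_eq0 n : (n%:R == 0 :> Zp) = (n == 0%N).
Proof.
apply/eqP/eqP => [|-> //] /(congr1 (fun z => residue z n)).
by rewrite residue_nat residue0 modn_small // ltn_expl ?prime_gt1.
Qed.

Lemma size_deriv_padic h : size h^`() = (size h).-1.
Proof. by apply: size_deriv_char0 => n; rewrite padic_natr_eq0. Qed.

(** Reduction modulo p; F_p[X] being a domain, it makes p a prime element of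
    Z_p[X]. *)
Definition padic_red (x : Zp) : 'F_p := (residue x 1)%:R.

Fact padic_red_zmod : zmod_morphism padic_red.
Proof.
have redD x y : padic_red (x + y) = padic_red x + padic_red y.
  by rewrite /padic_red /= expn1 Fp_nat_mod // natrD.
by move=> x y; apply/eqP; rewrite eq_sym subr_eq -redD subrK.
Qed.

Fact padic_red_monoid : monoid_morphism padic_red.
Proof.
split=> [|x y]; first by rewrite /padic_red /= expn1 Fp_nat_mod.
by rewrite /padic_red /= expn1 Fp_nat_mod // natrM.
Qed.

HB.instance Definition _ :=
  GRing.isZmodMorphism.Build Zp 'F_p padic_red padic_red_zmod.
HB.instance Definition _ :=
  GRing.isMonoidMorphism.Build Zp 'F_p padic_red padic_red_monoid.

Lemma padic_red_eq0 x : (padic_red x == 0) = pdvd 1 x.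
Proof.
rewrite /padic_red -(dvdn_pcharf (pchar_Fp p_pr)) /dvdn /pdvd.
by have := residue_mod x 1; rewrite expn1 => ->.
Qed.

Definition primitive h := map_poly padic_red h != 0.

Lemma primitivePn h :
  ~~ primitive h -> exists h1, h = p%:R *: h1.
Proof.
rewrite negbK => /eqP h0.
have hdvd i : {y | h`_i = p%:R * y}.
  apply: cid; apply: (pdvdP 1); rewrite -padic_red_eq0.
  by rewrite -coef_map h0 coef0.
exists (\poly_(i < size h) sval (hdvd i)); apply/polyP => i.
rewrite coefZ coef_poly; case: ltnP => hi; first by case: (hdvd i).
by rewrite nth_default // mulr0.
Qed.

Lemma primitiveM g h : primitive (g * h) = primitive g && primitive h.
Proof. by rewrite /primitive rmorphM mulf_eq0 negb_or. Qed.

Lemma primitive_prod (I : finType) (F : I -> {poly Zp}) :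
  (forall i, primitive (F i)) -> primitive (\prod_i F i).
Proof.
move=> prF; elim/big_rec: _ => [|i h _ prh]; last by rewrite primitiveM prF.
by rewrite /primitive rmorph1 oner_neq0.
Qed.

Lemma primitive_XsubC x : primitive ('X - x%:P).
Proof.
by rewrite /primitive rmorphB /= map_polyX map_polyC polyXsubC_eq0.
Qed.

(** Gauss's lemma: an equation c g = q h in Z_p[X] gives a factorization of g
    itself with factors of the same sizes, since each factor p of c divides q
    or h. It turns pseudo-division, which computes over Q_p, into honest
    factorizations over Z_p. *)
Lemma Gauss_factor (c : Zp) g q h : c != 0 -> c *: g = q * h ->
  exists q1 h1, [/\ g = q1 * h1, size q1 = size q & size h1 = size h].
Proof.
move=> /ord_decomp[u uu ->]; elim: (ord c) g q h => [|v IHv] g q h.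
  rewrite expr0 mul1r => E; exists (u^-1 *: q), h; split=> //.
    by rewrite -scalerAl -E scalerA mulVr // scale1r.
  by rewrite size_scale // invr_eq0; apply: contraTneq uu => ->; rewrite unitr0.
have p0 := padic_p_neq0 p_pr.
rewrite exprS -mulrA -scalerA => E.
have : ~~ primitive (q * h).
  by rewrite -E negbK map_polyZ /= rmorph_nat pchar_Fp_0 // scale0r.
have inj_p : injective (fun f : {poly Zp} => p%:R *: f).
  move=> f1 f2 /eqP; rewrite -subr_eq0 -scalerBr scale_poly_eq0 (negPf p0).
  by rewrite subr_eq0 => /eqP.
rewrite primitiveM negb_and => /orP[] /primitivePn[f fE].
  have /IHv[q1 [h1 [? sq sh]]] : (p%:R ^+ v * u) *: g = f * h.
    by apply: inj_p; rewrite E fE scalerAl.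
  by exists q1, h1; split=> //; rewrite sq fE size_scale.
have /IHv[q1 [h1 [? sq sh]]] : (p%:R ^+ v * u) *: g = q * f.
  by apply: inj_p; rewrite E fE scalerAr.
by exists q1, h1; split=> //; rewrite sh fE size_scale.
Qed.

Lemma poly_unit_size h : h \is a GRing.unit -> size h = 1%N.
Proof. by rewrite poly_unitE => /andP[/eqP]. Qed.

Lemma irreducible_primitive g :
  irreducible_elt g -> (1 < size g)%N -> primitive g.
Proof.
case=> g0 _ irr_g g1; apply: contraT => /primitivePn[h gE].
have gE' : g = p%:R%:P * h by rewrite mul_polyC.
have [|/poly_unit_size h1] := irr_g _ _ gE'; last first.
  by move: g1; rewrite gE size_scale ?padic_p_neq0 // h1.
rewrite poly_unitE coefC eqxx => /andP[_]; rewrite padic_unitE.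
by rewrite -[p%:R]mulr1 -[p%:R]expr1 pdvd_mull.
Qed.

(** In characteristic zero g' is a nonzero polynomial of smaller degree than g,
    so a nonconstant gcd of g and g' would be a proper factor of g over Q_p,
    hence by Gauss's lemma give a proper factorization over Z_p. *)
Lemma irreducible_separable g :
  irreducible_elt g -> (1 < size g)%N -> separable_poly g.
Proof.
case=> g0 _ irr_g g1; rewrite unlock coprimep_def eqn_leq size_poly_gt0.
have g'0 : g^`() != 0 by rewrite -size_poly_gt0 size_deriv_padic; lia.
rewrite gcdp_eq0 (negPf g0) andbT leqNgt; apply/negP => G1.
have /Pdiv.Idomain.dvdpP[[c q] /= c0 cE] := dvdp_gcdl g g^`().
have [q1 [h1 [gE sq sh]]] := Gauss_factor c0 cE.
have szG : (size (gcdp g g^`()) < size g)%N.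
  apply: leq_ltn_trans (lt_size_deriv g0).
  by apply: dvdp_leq => //; apply: dvdp_gcdr.
have q10 : q1 != 0 by apply: contraNneq g0 => q0; rewrite gE q0 mul0r.
have h10 : h1 != 0 by apply: contraNneq g0 => h0; rewrite gE h0 mulr0.
have := size_mul q10 h10; rewrite -gE sh => szg.
have [/poly_unit_size q1E|/poly_unit_size h1E] := irr_g _ _ gE.
  by move: szG; rewrite szg q1E add1n ltnn.
by move: G1; rewrite -sh h1E.
Qed.

Lemma separable_prod (I : eqType) (r : seq I) (F : I -> {poly Zp}) :
    uniq r -> (forall i, separable_poly (F i)) ->
    (forall i j, i != j -> coprimep (F i) (F j)) ->
  separable_poly (\prod_(i <- r) F i).
Proof.
move=> + sepF copF; elim: r => [_|i r IHr /= /andP[ir ur]].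
  by rewrite big_nil unlock coprime1p.
rewrite big_cons separable_mul sepF IHr //= big_seq.
elim/big_rec: _ => [|j q jr copq]; first exact: coprimep1.
by rewrite coprimepMr copq copF //; apply: contraNneq ir => ->.
Qed.

Section Key.
Variables (L : closedFieldType) (iota : {rmorphism {fraction Zp} -> L}).
Local Notation tofrac := (@FracField.tofrac Zp).

(** Where h is divisible by more than its discriminant, h' has at most half the
    valuation of the discriminant: the discriminant is an element of the ideal
    generated by h(a) and h'(a) ^ 2. So Hensel's lemma applies at such a point,
    without the factor 2 that a bound by the ideal of h(a) and h'(a) would
    cost. For a linear h, whose discriminant is 1 by convention, primitivity
    plays this role: p cannot divide both h(a) and the leading coefficient. *)
Lemma discriminant_dvd h : separable_poly h -> primitive h ->
  exists2 D : nat,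
    fine (padic_val (discriminant iota (map_poly tofrac h))) = D%:Z &
    forall a, pdvd D.+1 h.[a] -> h^`().[a] != 0 /\ ((ord h^`().[a]).*2 <= D)%N.
Proof.
move=> sep_h prim_h; have h0 := separable_poly_neq0 sep_h.
have sz_map : size (map_poly tofrac h) = size h.
  by rewrite size_map_poly_id0 // tofrac_eq0 lead_coef_eq0.
have fine1 : fine (padic_val (1 : {fraction Zp})) = 0%N%:Z.
  by rewrite -(rmorph1 tofrac) padic_val_ord ?oner_neq0 // ord_unit ?unitr1.
have [h2|] := ltnP 2 (size h).
  have [N ->] := discriminant_resultant iota h2 (size_deriv_padic h) sep_h.
  have res0 : resultant h^`() h != 0.
    move: sep_h; rewrite unlock coprimep_sym /coprimep resultant_eq0.
    by move=> /eqP ->.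
  have u_sign : (-1) ^+ N \is a @GRing.unit Zp by rewrite unitrX // unitrN1.
  exists (ord (resultant h^`() h)).
    rewrite padic_val_ord ?ordM_unit // mulf_neq0 //.
    by apply: contraTneq u_sign => ->; rewrite unitr0.
  move=> a ha; have [A [B]] := resultant_deriv_ideal a h2 (size_deriv_padic h).
  set res := resultant _ _ => resE.
  have n_dvd : ~~ pdvd (ord res).+1 (B * h^`().[a] ^+ 2).
    apply/negP => hB; have : pdvd (ord res).+1 res.
      by rewrite {2}resE pdvdD // pdvdMl.
    by rewrite pdvd_ord // ltnn.
  have h'a0 : h^`().[a] != 0.
    by apply: contraNneq n_dvd => ->; rewrite expr0n mulr0 pdvd0.
  split=> //; rewrite leqNgt; apply: contra n_dvd => lt_res.
  by apply: pdvdMl; rewrite pdvd_ord ?expf_neq0 // ordX // mul2n.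
move=> h2; exists 0%N.
  rewrite /discriminant sz_map.
  (* for a constant h the products over the roots are empty *)
  case: eqP => [//|h1]; have {}h1 : (size h).-1 = 0%N by lia.
  rewrite h1 /= big_ord0 mulr1.
  have one : iota 1 = 1 by rewrite rmorph1.
  case: xgetP => [D _ /= E|/(_ 1)[]]; last by rewrite /= one.
  by have -> : D = 1 by apply: (fmorph_inj iota); rewrite one.
move=> a ha.
have hE : h = h`_1 *: 'X + (h`_0)%:P.
  apply/polyP => -[|[|i]];
    rewrite coefD coefZ coefX coefC /= ?mulr0 ?mulr1 ?add0r ?addr0 //.
  by rewrite nth_default // (leq_trans h2).
have h'aE : h^`().[a] = h`_1.
  by rewrite {1}hE derivD derivZ derivX derivC addr0 hornerZ hornerC mulr1.
have h'u : h^`().[a] \is a GRing.unit.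
  rewrite padic_unitE h'aE; apply: contraL prim_h => h1; rewrite negbK.
  have haE : h`_0 = h.[a] - h`_1 * a.
    by rewrite {2}hE hornerD hornerZ hornerX hornerC addrAC subrr add0r.
  have h0d : pdvd 1 h`_0 by rewrite haE pdvdB // pdvdMr.
  apply/eqP/polyP => i; rewrite coef0 coef_map; apply/eqP; rewrite padic_red_eq0.
  by case: i => [|[|i]] //; rewrite nth_default ?pdvd0 // (leq_trans h2).
by rewrite ord_unit //; split=> //; apply: contraTneq h'u => ->; rewrite unitr0.
Qed.

End Key.
End PadicPoly.

(** * Values of products of factors *)

Section Factors.
Variables (p : nat) (p_pr : prime p).
Local Notation Zp := (padic_int p_pr).

Lemma ord_prod (I : finType) (P : pred I) (F : I -> Zp) :
    (forall i, P i -> F i != 0) ->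
  ord (\prod_(i | P i) F i) = (\sum_(i | P i) ord (F i))%N.
Proof.
move=> F0.
suff [] : \prod_(i | P i) F i != 0 /\
  ord (\prod_(i | P i) F i) = (\sum_(i | P i) ord (F i))%N by [].
elim/big_rec2: _ => [|i n x Pi [x0 <-]].
  by rewrite oner_neq0 ord_unit ?unitr1.
by rewrite mulf_neq0 ?ordM ?F0.
Qed.

Variables (I : finType) (psi : I -> {poly Zp}) (mu : I -> nat) (d : nat).
Hypothesis mu_d : forall s, (mu s <= d)%N.

Lemma ord_prodX (P : pred I) (x : Zp) : \prod_(s | P s) (psi s).[x] != 0 ->
  \prod_(s | P s) (psi s).[x] ^+ mu s != 0 /\
  (ord (\prod_(s | P s) (psi s).[x] ^+ mu s)%R <=
   d * ord (\prod_(s | P s) (psi s).[x])%R)%N.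
Proof.
move=> /prodf_neq0 h0; split.
  by apply/prodf_neq0 => s Ps; rewrite expf_neq0 ?h0.
rewrite !ord_prod => [|s Ps|s Ps]; rewrite ?expf_neq0 ?h0 // big_distrr /=.
by apply: leq_sum => s Ps; rewrite ordX ?h0 // leq_mul2r mu_d orbT.
Qed.

Lemma deriv_prod_root (s0 : I) (x : Zp) : psi s0 = 'X - x%:P ->
  (\prod_s psi s)^`().[x] = \prod_(s | s != s0) (psi s).[x].
Proof.
move=> s0E; rewrite (bigD1 s0) //= s0E derivM derivXsubC mul1r hornerD.
by rewrite hornerM hornerXsubC subrr mul0r addr0 horner_prod.
Qed.

(** The valuation of h' at the root x is the sum of those of the other factors
    psi s at x, so a point closer to x than this valuation leaves each of them
    unchanged up to a unit. *)
Lemma cofactor_near (s0 : I) (x a : Zp) : psi s0 = 'X - x%:P ->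
    (\prod_s psi s)^`().[x] != 0 ->
    pdvd (ord (\prod_s psi s)^`().[x]).+1 (a - x) ->
  assoc (\prod_(s | s != s0) (psi s).[a] ^+ mu s)
        (\prod_(s | s != s0) (psi s).[x] ^+ mu s).
Proof.
move=> s0E; rewrite (deriv_prod_root s0E) => h'0 ax.
have /prodf_neq0 F0 := h'0.
elim/big_rec2: _ => [|s y z ss0 yz]; first exact: assoc_refl.
apply: assocM => //; apply: assocX; apply: assoc_near; first exact: F0.
apply: pdvd_horner; apply: pdvd_leq ax; rewrite ltnS ord_prod //.
by rewrite (bigD1 s) //= leq_addr.
Qed.

End Factors.

(** * Counting residues *)

Section Count.
Variables (p : nat) (p_pr : prime p).
Local Notation Zp := (padic_int p_pr).

Lemma card_modn_eq N M Q r : N = (M * Q)%N -> (r < M)%N ->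
  #|[set a : 'I_N | (a %% M == r)%N]| = Q.
Proof.
move=> NE rM.
have lt (q : 'I_Q) : (q * M + r < N)%N.
  have := ltn_ord q; rewrite NE => /(leq_mul (leqnn M)).
  rewrite mulnS [(M * q)%N]mulnC.
  by apply: leq_trans; rewrite addnC ltn_add2r.
rewrite -[RHS]card_ord -(card_imset predT (f := fun q => Ordinal (lt q))).
  congr #|pred_of_set _|; apply/setP => a; rewrite inE; apply/eqP/imsetP => [ar|].
    have aQ : (a %/ M < Q)%N.
      by rewrite ltn_divLR ?(leq_ltn_trans _ rM) // mulnC -NE.
    by exists (Ordinal aQ) => //; apply: val_inj; rewrite /= -ar -divn_eq.
  by case=> q _ ->; rewrite /= modnMDl modn_small.
move=> q1 q2 /(congr1 val) /= /addIn /eqP.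
rewrite eqn_pmul2r ?(leq_ltn_trans _ rM) // => /eqP; exact: val_inj.
Qed.

Lemma card_ball k c (x : Zp) : (c <= k)%N ->
  #|[set a : 'I_(p ^ k) | pdvd c (a%:R - x)]| = (p ^ (k - c))%N.
Proof.
move=> ck; under eq_finset do rewrite pdvd_subE residue_nat.
by apply: card_modn_eq; rewrite ?residue_lt // -expnD subnKC.
Qed.

Lemma pdvd_intr k (z : int) :
  pdvd k (z%:~R : Zp) = (z == 0 %[mod (p ^ k)%N%:Z])%Z.
Proof.
rewrite eqz_mod_dvd subr0 dvdzE /=; case: z => n.
  by rewrite -pmulrn /pdvd residue_nat.
by rewrite NegzE mulrNz -pmulrn pdvdN /pdvd residue_nat.
Qed.

Lemma zero_countE k (f : {poly int}) :
  zero_count p k f =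
  #|[set a : 'I_(p ^ k) | pdvd k ((map_poly intr f).[a%:R] : Zp)]|.
Proof.
congr #|pred_of_set _|; apply/setP => a; rewrite !inE.
by rewrite -pdvd_intr -horner_map /= -pmulrn.
Qed.

End Count.

(** The ceiling is the least t such that v + e t reaches k; this Galois
    connection is the form in which it describes the radius of a ball. *)
Lemma ceil_threshold (k v e : nat) : (0 < e)%N -> (v <= k)%N ->
  exists2 c : nat, Num.ceil ((k%:Z - v%:Z)%:~R / e%:R : rat) = c%:Z &
    forall t, (c <= t)%N = (k <= v + e * t)%N.
Proof.
move=> e0 vk; have e0' : (0 : rat) < e%:R by rewrite ltr0n.
set x := _ / _.
have x0 : 0 <= x by rewrite divr_ge0 // ler0z subr_ge0 lez_nat.
have c0 : 0 <= Num.ceil x by rewrite -(ceil0 rat) le_ceil.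
exists `|Num.ceil x|%N; first by rewrite gez0_abs.
move=> t; rewrite -lez_nat gez0_abs // ceil_le_int ler_pdivrMr //.
rewrite -[e%:R]/(e%:Z%:~R) -intrM ler_int.
lia.
Qed.

(** * The solutions as a union of balls *)

Section RootBalls.
Variables (p : nat) (p_pr : prime p).
Local Notation Zp := (padic_int p_pr).
Variables (I : finType) (psi : I -> {poly Zp}) (mu : I -> nat).
Variables (n : nat) (alpha : 'I_n -> Zp) (idx : 'I_n -> I).
Hypothesis mu_gt0 : forall s, (0 < mu s)%N.
Hypothesis alpha_inj : injective alpha.
Hypothesis psi_idx : forall i, psi (idx i) = 'X - (alpha i)%:P.
Hypothesis psi_root : forall s x, root (psi s) x -> exists i, x = alpha i.
Let h := \prod_s psi s.
Variable D : nat.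
Hypothesis h'_small : forall a, pdvd D.+1 h.[a] ->
  h^`().[a] != 0 /\ ((ord h^`().[a]).*2 <= D)%N.
Variables (u : Zp) (f : {poly Zp}).
Hypothesis uu : u \is a GRing.unit.
Hypothesis fE : f = u *: \prod_s psi s ^+ mu s.
Variable d : nat.
Hypothesis mu_d : forall s, (mu s <= d)%N.

Let W i := ord h^`().[alpha i].
(** W i is also the total valuation at alpha i of the other factors of h, so
    near a i makes each of them agree at a and at alpha i to more than its own
    valuation. *)
Let near a i := pdvd (W i).+1 (a - alpha i).
Definition cofactor_value i := \prod_(s | s != idx i) (psi s).[alpha i] ^+ mu s.

Lemma h_root i : h.[alpha i] = 0.
Proof.
by rewrite horner_prod (bigD1 (idx i)) //= psi_idx hornerXsubC subrr mul0r.
Qed.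

Lemma h'_root i : h^`().[alpha i] != 0 /\ ((W i).*2 <= D)%N.
Proof. by apply: h'_small; rewrite h_root pdvd0. Qed.

Lemma cofactor_value_bound i :
  cofactor_value i != 0 /\ (ord (cofactor_value i) <= d * W i)%N.
Proof.
have [h'0 _] := h'_root i; rewrite /W (deriv_prod_root (psi_idx i)).
by apply: ord_prodX => //; rewrite -(deriv_prod_root (psi_idx i)).
Qed.

Lemma idx_inj : injective idx.
Proof.
move=> i j ij; apply: alpha_inj; have := psi_idx i; rewrite ij psi_idx.
move=> /(congr1 (fun q => q.[alpha i])).
by rewrite !hornerXsubC subrr => /subr0_eq.
Qed.

Lemma root_gap i j : i != j ->
  alpha i - alpha j != 0 /\ (ord (alpha i - alpha j)%R <= W i)%N.
Proof.
move=> ij; rewrite subr_eq0 (inj_eq alpha_inj); split=> //.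
have [] := h'_root i; rewrite /W (deriv_prod_root (psi_idx i)) => h'0 _.
have ji : idx j != idx i by rewrite (inj_eq idx_inj) eq_sym.
move: h'0; rewrite (bigD1 (idx j)) //= psi_idx hornerXsubC => h'0.
exact: ord_dvd.
Qed.

(** The difference of two roots is a factor of h' at either of them, so its
    valuation is at most both W i and W j; a point near both roots would make it
    larger than the smaller of the two. *)
Lemma near_uniq a i j : near a i -> near a j -> i = j.
Proof.
wlog le_ij : i j / (W i <= W j)%N.
  move=> wl ni nj; have [/wl->//|/ltnW/wl wl'] := leqP (W i) (W j).
  by apply/esym/wl'.
move=> ni nj; apply/eqP; apply: contraT => /root_gap[nz].
rewrite leqNgt -pdvd_ord // => /negP[].
have -> : alpha i - alpha j = (a - alpha j) - (a - alpha i).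
  by rewrite opprB [RHS]addrC addrA subrK.
by rewrite pdvdB //; apply: pdvd_leq nj.
Qed.

Lemma horner_near a i : near a i ->
  assoc f.[a] ((a - alpha i) ^+ mu (idx i) * cofactor_value i).
Proof.
move=> ni; have [h'0 _] := h'_root i.
rewrite fE hornerZ horner_prod (bigD1 (idx i)) //= -[X in assoc _ X]mul1r.
apply: assocM; first by exists u => //; rewrite mulr1.
rewrite horner_exp psi_idx hornerXsubC.
apply: assocM; first exact: assoc_refl.
under eq_bigr do rewrite horner_exp.
exact: (cofactor_near mu (psi_idx i) h'0 ni).
Qed.

Variable k : nat.
Hypothesis k_gt : (d * D.+1 < k)%N.

(** All multiplicities are at most d, so f divides the d-th power of h up to a
    unit: if h(a) had valuation at most D, then f(a) would have valuation at
    most d D. *)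
Lemma radical_dvd a : pdvd k f.[a] -> pdvd D.+1 h.[a].
Proof.
apply: contraTT => hD; have h0 : h.[a] != 0.
  by apply: contraNneq hD => ->; rewrite pdvd0.
rewrite pdvd_ord // -ltnNge ltnS in hD.
have := h0; rewrite /h horner_prod => /(@ord_prodX _ _ _ _ mu d mu_d)[f0 fd].
rewrite fE hornerZ pdvdM_unit // horner_prod.
under eq_bigr do rewrite horner_exp.
rewrite pdvd_ord // -ltnNge; apply: leq_ltn_trans fd _.
rewrite -horner_prod; apply: leq_ltn_trans k_gt.
by rewrite leq_mul2l (leq_trans hD) ?orbT.
Qed.

Lemma dvd_near a : pdvd k f.[a] -> exists i, near a i.
Proof.
move=> /radical_dvd hD; have [h'0 h'D] := h'_small hD.
have [|x xr xa] := Hensel h'0; first exact: pdvd_leq hD.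
have [s /psi_root[i xE]] : exists s, root (psi s) x.
  move: xr; rewrite /root horner_prod => /prodf_eq0[s _ hs]; by exists s.
exists i; rewrite /near /W -xE -pdvdN opprB.
have [|_ ->//] := ord_near (x := h^`().[x]) h'0.
exact: pdvd_horner.
Qed.

Variable c : 'I_n -> nat.
Hypothesis cP : forall i t,
  (c i <= t)%N = (k <= ord (cofactor_value i) + mu (idx i) * t)%N.

Lemma dvd_ball a i : near a i -> pdvd k f.[a] = pdvd (c i) (a - alpha i).
Proof.
case/horner_near => v uv ->; rewrite pdvdM_unit //.
have [cof0 _] := cofactor_value_bound i.
have [->|x0] := eqVneq (a - alpha i) 0.
  by rewrite expr0n eqn0Ngt mu_gt0 mul0r !pdvd0.
rewrite !pdvd_ord ?mulf_neq0 ?expf_neq0 // cP.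
by rewrite ordM ?expf_neq0 // ordX // addnC.
Qed.

(** The ball of radius c i is contained in the neighbourhood where f(a) is
    understood: 2 W i <= D gives
    ord (cofactor_value i) + mu (idx i) * W i <= 2 d W i <= d D < k. *)
Lemma ball_near a i : pdvd (c i) (a - alpha i) -> near a i.
Proof.
apply: pdvd_leq; rewrite ltnNge cP -ltnNge; apply: leq_ltn_trans k_gt.
have [_ cofW] := cofactor_value_bound i; have [_ WD] := h'_root i.
have eW : (mu (idx i) * W i <= d * W i)%N by rewrite leq_mul2r mu_d orbT.
apply: leq_trans (leq_add cofW eW) _; rewrite -mulnDr addnn leq_mul2l.
by rewrite (leq_trans WD) ?orbT.
Qed.

Lemma dvd_sum_balls a :
  pdvd k f.[a] = (\sum_i pdvd (c i) (a - alpha i)%R)%N :> nat.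
Proof.
have [hf|hf] := boolP (pdvd k f.[a]); last first.
  rewrite big1 // => i _; apply/eqP; rewrite eqb0; apply: contra hf => hi.
  by rewrite (dvd_ball (ball_near hi)).
have [i ni] := dvd_near hf.
rewrite (bigD1 i) //= -(dvd_ball ni) hf big1 // => j ji.
apply/eqP; rewrite eqb0; apply: contra ji => /ball_near nj.
by apply/eqP; apply: near_uniq nj ni.
Qed.

Lemma sum_balls :
  #|[set a : 'I_(p ^ k) | pdvd k (f.[a%:R] : Zp)]| =
  (\sum_i #|[set a : 'I_(p ^ k) | pdvd (c i) (a%:R - alpha i)%R]|)%N.
Proof.
rewrite -sum1dep_card big_mkcond /=.
under [RHS]eq_bigr do rewrite -sum1dep_card big_mkcond /=.
rewrite exchange_big; apply: eq_bigr => a _.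
transitivity (nat_of_bool (pdvd k f.[a%:R])); first by case: pdvd.
by rewrite dvd_sum_balls; apply: eq_bigr => i _; case: pdvd.
Qed.

End RootBalls.

(** * The factorization of f *)

Section FactorFamily.
Variables (p : nat) (p_pr : prime p).
Local Notation Zp := (padic_int p_pr).
Variables (n m : nat) (alpha : 'I_n -> Zp) (e : 'I_n -> nat).
Variables (g : 'I_m -> {poly Zp}) (t : 'I_m -> nat).

(** The factors X - alpha_i and the factors g_j as one family, so that the
    arguments about factors need no distinction between them. *)
Definition factor (s : 'I_n + 'I_m) : {poly Zp} :=
  match s with inl i => 'X - (alpha i)%:P | inr j => g j end.

Definition mult (s : 'I_n + 'I_m) : nat :=
  match s with inl i => e i | inr j => t j end.

Lemma radical_factor : radical alpha g = \prod_s factor s.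
Proof. by rewrite big_sumType. Qed.

Variable f : {poly Zp}.
Hypothesis f_fact : is_factorization alpha e g t f.

Lemma factorE : exists2 u : Zp, u \is a GRing.unit &
  f = u *: \prod_s factor s ^+ mult s.
Proof.
by have [u uu fE] := Defs.factE f_fact; exists u; rewrite // big_sumType.
Qed.

Lemma mult_gt0 s : (0 < mult s)%N.
Proof. by case: s => i; [apply: (e_gt0 f_fact) | apply: (t_gt0 f_fact)]. Qed.

Lemma factor_root s x : root (factor s) x -> exists i, x = alpha i.
Proof.
case: s => [i|j] /=; last by rewrite (negPf (g_noroot f_fact j x)).
by rewrite root_XsubC => /eqP ->; exists i.
Qed.

Lemma size_factor s : (1 < size (factor s))%N.
Proof. by case: s => [i|j] /=; [rewrite size_XsubC | apply: (g_deg f_fact)]. Qed.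

Lemma factor_neq0 s : factor s != 0.
Proof. by rewrite -size_poly_gt0 (ltn_trans _ (size_factor s)). Qed.

Lemma radical_separable : separable_poly (radical alpha g).
Proof.
rewrite radical_factor; apply: separable_prod => [|[i|j]|[i|j] [i'|j']] /=.
- exact: index_enum_uniq.
- by rewrite unlock derivXsubC coprimep1.
- exact: irreducible_separable (g_irr f_fact j) (g_deg f_fact j).
- move=> ij; apply: coprimep_XsubC2.
  rewrite subr_eq0 (inj_eq (alpha_inj f_fact)).
  by apply: contra ij => /eqP ->.
- by move=> _; rewrite coprimep_sym coprimep_XsubC (g_noroot f_fact).
- by move=> _; rewrite coprimep_XsubC (g_noroot f_fact).
- by move=> jj; apply: (g_coprime f_fact); apply: contra jj => /eqP ->.
Qed.

Lemma radical_primitive : primitive (radical alpha g).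
Proof.
rewrite radical_factor; apply: primitive_prod => -[i|j].
  exact: primitive_XsubC.
exact: irreducible_primitive (g_irr f_fact j) (g_deg f_fact j).
Qed.

Lemma mult_leq_deg d s : size f = d.+1 -> (mult s <= d)%N.
Proof.
have [u uu ->] := factorE.
rewrite size_scale; last by apply: contraTneq uu => ->; rewrite unitr0.
have F0 r : factor r ^+ mult r != 0 by rewrite expf_neq0 ?factor_neq0.
rewrite (bigD1 s) //=; set q := \prod_(_ | _) _ => szf.
have q0 : q != 0 by apply/prodf_neq0 => r _; apply: F0.
have szq : (0 < size q)%N by rewrite size_poly_gt0.
have := size_mul (F0 s) q0; rewrite szf => szE.
have := size_exp (factor s) (mult s); have := size_factor s.
have szF : (0 < size (factor s ^+ mult s))%N by rewrite size_poly_gt0.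
move: (size _) szF szE => a szF szE.
move: (size _) szq szE => b szq szE.
move: (size _) => l l1 aE.
have -> : d = (a.-1 + b.-1)%N by lia.
rewrite aE; apply: leq_trans (leq_addr _ _).
by rewrite -{1}[mult s]mul1n leq_mul2r -ltnS prednK ?l1 ?orbT // ltnW.
Qed.

Lemma nuE i : let r := cofactor_value factor mult alpha inl i in
  r != 0 -> nu alpha e f i = (ord r)%:Z.
Proof.
move=> r r0; have [u uu fE] := factorE.
have cofE : cofactor_at alpha e f i =
    u *: \prod_(s | s != inl i) factor s ^+ mult s.
  by rewrite fE (bigD1 (inl i)) //= scalerAr mulrC cofactor_atE.
rewrite /nu cofE hornerZ horner_prod.
under eq_bigr do rewrite horner_exp.
rewrite padic_val_ord ?ordM_unit // mulf_neq0 //.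
by apply: contraTneq uu => ->; rewrite unitr0.
Qed.

End FactorFamily.

Theorem theorem19 (p : nat) (p_pr : prime p) (f : {poly int}) (d : nat)
    (f_deg : size f = d.+1)
    (n m : nat) (alpha : 'I_n -> padic_int p_pr) (e : 'I_n -> nat)
    (g : 'I_m -> {poly padic_int p_pr}) (t : 'I_m -> nat)
    (f_fact : is_factorization alpha e g t (map_poly intr f))
    (L : closedFieldType) (iota : {rmorphism {fraction padic_int p_pr} -> L})
    (L_closure : is_algebraic_closure iota)
    (k : nat) (k_gt : d%:Z * (Delta alpha g iota + 1) < k%:Z) :
  (zero_count p k f)%:R =
  \sum_(i < n) (p%:R : rat) ^
    (k%:Z - Num.ceil ((k%:Z - nu alpha e (map_poly intr f) i)%:~R
                      / (e i)%:R : rat)).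
Proof.
set F := map_poly intr f in f_fact *.
have szF : size F = d.+1.
  rewrite -f_deg; apply: size_map_poly_id0.
  have : lead_coef f != 0 by rewrite lead_coef_eq0 -size_poly_gt0 f_deg.
  case: (lead_coef f) => l; first by rewrite -pmulrn padic_natr_eq0.
  by move=> _; rewrite NegzE mulrNz oppr_eq0 -pmulrn padic_natr_eq0.
have [D DeltaE h'_small] := discriminant_dvd iota
  (radical_separable f_fact) (radical_primitive f_fact).
have {}k_gt : (d * D.+1 < k)%N by move: k_gt; rewrite /Delta DeltaE; lia.
rewrite radical_factor in h'_small.
have [u uu fE] := factorE f_fact.
have mu_d s := mult_leq_deg f_fact s szF.
pose cof := cofactor_value (factor alpha g) (mult e t) alpha inl.
have cofB i : cof i != 0 /\ (ord (cof i) <= k)%N.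
  have [c0 cB] := cofactor_value_bound (alpha := alpha) (idx := inl)
    (fun=> erefl) h'_small mu_d i.
  have [_ WD] := h'_root (alpha := alpha) (idx := inl)
    (fun=> erefl) h'_small i.
  split=> //; apply: leq_trans cB _; apply: leq_trans (ltnW k_gt).
  by rewrite leq_mul2l; apply/orP; right; lia.
have c_ex i : {c : nat | Num.ceil ((k%:Z - nu alpha e F i)%:~R / (e i)%:R : rat)
    = c%:Z & forall t, (c <= t)%N = (k <= ord (cof i) + e i * t)%N}.
  apply: cid2; have [cof0 cofk] := cofB i.
  rewrite (nuE f_fact cof0).
  by apply: ceil_threshold => //; apply: (e_gt0 f_fact).
have [c cE cP] : exists2 c : 'I_n -> nat,
    forall i, Num.ceil ((k%:Z - nu alpha e F i)%:~R / (e i)%:R : rat) = c i &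
    forall i t, (c i <= t)%N = (k <= ord (cof i) + e i * t)%N.
  by exists (fun i => s2val (c_ex i)) => i; case: (c_ex i).
rewrite zero_countE (sum_balls (alpha := alpha) (idx := inl)
  (mult_gt0 f_fact) (alpha_inj f_fact) (fun=> erefl) (factor_root f_fact)
  h'_small uu fE mu_d k_gt cP) natr_sum.
apply: eq_bigr => i _; rewrite cE.
have ck : (c i <= k)%N.
  rewrite cP; apply: leq_trans (leq_addl _ _).
  by rewrite leq_pmull // (e_gt0 f_fact).
by rewrite card_ball // subzn // natrX.
Qed.
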